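(* Let $(\mathcal{P}_1,\{\,,\}_1,\bullet_1)$ and $(\mathcal{P}_2,\{\,,\}_2,\bullet_2)$ be two Poisson superalgebras over $\mathbb{K}$. Let $\rho_1,\varphi_1:\mathcal{P}_1\to End(\mathcal{P}_2)$ and $\rho_2,\varphi_2:\mathcal{P}_2\to End(\mathcal{P}_1)$ be four even linear maps such that $(\mathcal{P}_1,\mathcal{P}_2,\rho_1,\rho_2)$ is a matched pair of Lie superalgebras (for the brackets $\{\,,\}_1,\{\,,\}_2$) and $(\mathcal{P}_1,\mathcal{P}_2,\varphi_1,\varphi_2)$ is a matched pair of commutative associative superalgebras (for $\bullet_1,\bullet_2$). Suppose in addition that $(\mathcal{P}_2,\rho_1,\varphi_1)$ is a representation of the Poisson superalgebra $\mathcal{P}_1$, that $(\mathcal{P}_1,\rho_2,\varphi_2)$ is a representation of the Poisson superalgebra $\mathcal{P}_2$, and that for all homogeneous $x,y\in\mathcal{P}_1$ and $a,b\in\mathcal{P}_2$: $$\rho_2(a)(x\bullet_1y)=(\rho_2(a)x)\bullet_1y+(-1)^{|a||x|}x\bullet_1(\rho_2(a)y)-(-1)^{|a||x|}\varphi_2(\rho_1(x)a)y-(-1)^{|a||y|+|x||y|}\varphi_2(\rho_1(y)a)x,$$ $$\{x,\varphi_2(a)y\}_1-(-1)^{|x||a|+|x||y|+|a||y|}\rho_2(\varphi_1(y)a)x=\varphi_2(\rho_1(x)a)y-(-1)^{|x||a|}(\rho_2(a)x)\bullet_1y+(-1)^{|x||a|}\varphi_2(a)(\{x,y\}_1),$$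 $$\rho_1(x)(a\bullet_2b)=(\rho_1(x)a)\bullet_2b+(-1)^{|x||a|}a\bullet_2(\rho_1(x)b)-(-1)^{|x||a|}\varphi_1(\rho_2(a)x)b-(-1)^{|x||b|+|a||b|}\varphi_1(\rho_2(b)x)a,$$ $$\{a,\varphi_1(x)b\}_2-(-1)^{|a||x|+|a||b|+|x||b|}\rho_1(\varphi_2(b)x)a=\varphi_1(\rho_2(a)x)b-(-1)^{|a||x|}(\rho_1(x)a)\bullet_2b+(-1)^{|a||x|}\varphi_1(x)(\{a,b\}_2).$$ Then the $\mathbb{Z}_2$-graded vector space $\mathcal{P}_1\oplus\mathcal{P}_2$ is a Poisson superalgebra under the operations $$\{x+a,y+b\}=\big(\{x,y\}_1+\rho_2(a)y-(-1)^{|x||y|}\rho_2(b)x\big)+\big(\{a,b\}_2+\rho_1(x)b-(-1)^{|x||y|}\rho_1(y)a\big),$$ $$(x+a)\bullet(y+b)=\big(x\bullet_1y+\varphi_2(a)y+(-1)^{|x||y|}\varphi_2(b)x\big)+\big(a\bullet_2b+\varphi_1(x)b+(-1)^{|x||y|}\varphi_1(y)a\big),$$ for homogeneous elements $x+a$, $y+b$ with $x,y\in\mathcal{P}_1$, $a,b\in\mathcal{P}_2$, $|x+a|=|x|=|a|$ and $|y+b|=|y|=|b|$.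
   Context: $\mathbb{K}$ is a field of characteristic $0$; $|x|\in\mathbb{Z}_2$ is the parity of a homogeneous element. Poisson superalgebra $(\mathcal{P},\{\,,\},\bullet)$: a $\mathbb{Z}_2$-graded vector space with two even bilinear maps such that for homogeneous $x,y,z$: (i) $\{x,y\}=-(-1)^{|x||y|}\{y,x\}$ and $(-1)^{|x||z|}\{x,\{y,z\}\}+(-1)^{|z||y|}\{z,\{x,y\}\}+(-1)^{|y||x|}\{y,\{z,x\}\}=0$ (Lie superalgebra); (ii) $x\bullet y=(-1)^{|x||y|}y\bullet x$ and $x\bullet(y\bullet z)=(x\bullet y)\bullet z$ (commutative associative superalgebra); (iii) $\{x,y\bullet z\}=\{x,y\}\bullet z+(-1)^{|x||y|}y\bullet\{x,z\}$. Representations: an even linear map $\rho:\mathcal{A}\to End(V)$ is a representation of a Lie superalgebra $(\mathcal{A},[\,,])$ if $\rho([x,y])=\rho(x)\rho(y)-(-1)^{|x||y|}\rho(y)\rho(x)$; an even linear map $\varphi:\mathcal{A}\to End(V)$ is a representation of a commutative associative superalgebra $(\mathcal{A},\bullet)$ if $\varphi(x\bullet y)=\varphi(x)\varphi(y)$. $(V,\psi_{\{,\}},\psi_\bullet)$ is a representation of a Poisson superalgebra $(\mathcal{P},\{\,,\},\bullet)$ if $\psi_{\{,\}}$ is a representation of $(\mathcal{P},\{\,,\})$, $\psi_\bullet$ is a representation of $(\mathcal{P},\bullet)$, and $\psi_{\{,\}}(x\bullet y)=\psi_\bullet(x)\psi_{\{,\}}(y)+(-1)^{|x||y|}\psi_\bullet(y)\psi_{\{,\}}(x)$,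 $\psi_\bullet(\{x,y\})=\psi_{\{,\}}(x)\psi_\bullet(y)-(-1)^{|x||y|}\psi_\bullet(y)\psi_{\{,\}}(x)$. Matched pair of Lie superalgebras $(\mathcal{A},\mathcal{A}',\rho,\rho')$: $\rho:\mathcal{A}\to End(\mathcal{A}')$, $\rho':\mathcal{A}'\to End(\mathcal{A})$ are representations of Lie superalgebras and, for homogeneous $x,y,z\in\mathcal{A}$, $x',y',z'\in\mathcal{A}'$, $\rho'(z')[x,y]=[\rho'(z')x,y]+(-1)^{|x||z'|}[x,\rho'(z')y]+(-1)^{|x||y|+|y||z'|}\rho'(\rho(y)z')x-(-1)^{|x||z'|}\rho'(\rho(x)z')y$, $\rho(z)[x',y']=[\rho(z)x',y']+(-1)^{|x'||z|}[x',\rho(z)y']+(-1)^{|x'||y'|+|y'||z|}\rho(\rho'(y')z)x'-(-1)^{|x'||z|}\rho(\rho'(x')z)y'$. Matched pair of commutative associative superalgebras $(\mathcal{A}_1,\mathcal{A}_2,\varphi_1,\varphi_2)$: $\varphi_1:\mathcal{A}_1\to End(\mathcal{A}_2)$, $\varphi_2:\mathcal{A}_2\to End(\mathcal{A}_1)$ are representations and $\varphi_1(x)(a\bullet_2b)=(\varphi_1(x)a)\bullet_2b+(-1)^{|x||a|}\varphi_1(\varphi_2(a)x)b$, $\varphi_2(a)(x\bullet_1y)=(\varphi_2(a)x)\bullet_1y+(-1)^{|x||a|}\varphi_2(\varphi_1(x)a)y$ for homogeneous $x,y\in\mathcal{A}_1$, $a,b\in\mathcal{A}_2$. *)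

(* Defs.v *)
From HB Require Import structures.
From mathcomp Require Import all_boot all_order all_algebra.

Set Implicit Arguments.
Unset Strict Implicit.
Unset Printing Implicit Defensive.

Import GRing.Theory.
Local Open Scope ring_scope.

(* [homog i] is the subspace of homogeneous elements of parity [i], where
   Z_2 is [bool] with [(+)] as its addition; the last three fields say that
   the space is the direct sum of [homog false] and [homog true], and [part]
   is then determined. The zero vector is homogeneous of both parities. *)
Record superspace (K : fieldType) := Superspace {
  superspace_sort :> lmodType K;
  homog : bool -> {pred superspace_sort};
  part : bool -> superspace_sort -> superspace_sort;
  homog_submod : forall i, submod_closed (homog i);
  homog_part : forall i x, part i x \in homog i;
  part_sum : forall x, x = part false x + part true x;
  homog_disjoint : forall x, x \in homog false -> x \in homog true -> x = 0
}.

Arguments homog {K} s i : rename.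
Arguments part {K} s i x : rename.

Section SuperspaceTheory.

Variables (K : fieldType) (V : superspace K).

Lemma homog0 i : 0 \in homog V i.
Proof. by have [] := homog_submod V i. Qed.

Lemma homogB i x y : x \in homog V i -> y \in homog V i -> x - y \in homog V i.
Proof. by have [_ /GRing.linear_closedB] := homog_submod V i; apply. Qed.

Lemma part_homog i j x : x \in homog V i -> part V j x = if j == i then x else 0.
Proof.
move=> hx; have ds z t : z \in homog V i -> t \in homog V (~~ i) ->
    x = z + t -> z = x /\ t = 0.
  move=> hz ht xE.
  have hxz : x - z = t by rewrite xE addrC addKr.
  have t0 : t = 0.
    have ti : t \in homog V i by rewrite -hxz homogB.
    by case: (i) ht ti => ht ti; apply: homog_disjoint.
  by split=> //; rewrite xE t0 addr0.
have [] := ds (part V i x) (part V (~~ i) x) (homog_part _ _) (homog_part _ _).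
  by rewrite {1}[x]part_sum; case: (i); rewrite //= addrC.
by case: (i) j => -[].
Qed.

End SuperspaceTheory.

Section DirectSum.

Variables (K : fieldType) (V W : superspace K).

Let sort : lmodType K := (V * W)%type.
Let hom i : {pred sort} := [pred u | (u.1 \in homog V i) && (u.2 \in homog W i)].
Let prt i (u : sort) : sort := (part V i u.1, part W i u.2).

Fact dsum_submod i : submod_closed (hom i).
Proof.
have [V0 Vl] := homog_submod V i; have [W0 Wl] := homog_submod W i.
split=> [|a u v]; first by rewrite inE V0 W0.
by rewrite !inE => /andP[u1 u2] /andP[v1 v2]; rewrite Vl ?Wl.
Qed.

Fact dsum_part i u : prt i u \in hom i.
Proof. by rewrite inE !homog_part. Qed.

Fact dsum_part_sum u : u = prt false u + prt true u.
Proof. by case: u => x a; rewrite {1}[x]part_sum {1}[a]part_sum. Qed.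

Fact dsum_disjoint u : u \in hom false -> u \in hom true -> u = 0.
Proof.
case: u => x a; rewrite !inE /= => /andP[x0 a0] /andP[x1 a1].
by rewrite (homog_disjoint x0 x1) (homog_disjoint a0 a1).
Qed.

Definition dsum : superspace K :=
  Superspace dsum_submod dsum_part dsum_part_sum dsum_disjoint.

End DirectSum.

Definition even_bilinear (K : fieldType) (U V W : superspace K)
    (f : U -> V -> W) : Prop :=
  [/\ forall v, linear (f^~ v),
      forall u, linear (f u)
    & forall i j u v, u \in homog U i -> v \in homog V j ->
        f u v \in homog W (i (+) j)].

Section SuperAlgebra.

Variable K : fieldType.

(* Parities are coerced to [nat] in the exponents of the signs. *)

Definition lie_superalgebra (A : superspace K) (br : A -> A -> A) : Prop :=
  [/\ even_bilinear br,
      forall (i j : bool) x y, x \in homog A i -> y \in homog A j ->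
        br x y = - ((-1) ^+ (i * j) *: br y x)
    & forall (i j k : bool) x y z,
        x \in homog A i -> y \in homog A j -> z \in homog A k ->
        (-1) ^+ (i * k) *: br x (br y z) + (-1) ^+ (k * j) *: br z (br x y)
          + (-1) ^+ (j * i) *: br y (br z x) = 0].

Definition comm_assoc_superalgebra (A : superspace K) (mul : A -> A -> A) : Prop :=
  [/\ even_bilinear mul,
      forall (i j : bool) x y, x \in homog A i -> y \in homog A j ->
        mul x y = (-1) ^+ (i * j) *: mul y x
    & forall (i j k : bool) x y z,
        x \in homog A i -> y \in homog A j -> z \in homog A k ->
        mul x (mul y z) = mul (mul x y) z].

Definition poisson_superalgebra (P : superspace K) (br mul : P -> P -> P) : Prop :=
  [/\ lie_superalgebra br,
      comm_assoc_superalgebra mul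
    & forall (i j k : bool) x y z,
        x \in homog P i -> y \in homog P j -> z \in homog P k ->
        br x (mul y z) = mul (br x y) z + (-1) ^+ (i * j) *: mul y (br x z)].

(* An even linear map from [A] to the endomorphisms of [V] is represented by
   the even bilinear map [A -> V -> V] obtained by uncurrying it. *)

Definition lie_representation (A V : superspace K) (br : A -> A -> A)
    (rho : A -> V -> V) : Prop :=
  even_bilinear rho /\
  forall (i j : bool) x y, x \in homog A i -> y \in homog A j -> forall v,
    rho (br x y) v = rho x (rho y v) - (-1) ^+ (i * j) *: rho y (rho x v).

Definition assoc_representation (A V : superspace K) (mul : A -> A -> A)
    (phi : A -> V -> V) : Prop :=
  even_bilinear phi /\
  forall (i j : bool) x y, x \in homog A i -> y \in homog A j -> forall v,
    phi (mul x y) v = phi x (phi y v).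

Definition poisson_representation (P V : superspace K) (br mul : P -> P -> P)
    (psi_br psi_mul : P -> V -> V) : Prop :=
  [/\ lie_representation br psi_br,
      assoc_representation mul psi_mul,
      forall (i j : bool) x y, x \in homog P i -> y \in homog P j -> forall v,
        psi_br (mul x y) v =
        psi_mul x (psi_br y v) + (-1) ^+ (i * j) *: psi_mul y (psi_br x v)
    & forall (i j : bool) x y, x \in homog P i -> y \in homog P j -> forall v,
        psi_mul (br x y) v =
        psi_br x (psi_mul y v) - (-1) ^+ (i * j) *: psi_mul y (psi_br x v)].

Definition lie_matched_pair (A A' : superspace K)
    (br : A -> A -> A) (br' : A' -> A' -> A')
    (rho : A -> A' -> A') (rho' : A' -> A -> A) : Prop :=
  [/\ lie_representation br rho,
      lie_representation br' rho',
      forall (i j k : bool) x y z',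
        x \in homog A i -> y \in homog A j -> z' \in homog A' k ->
        rho' z' (br x y) =
          br (rho' z' x) y + (-1) ^+ (i * k) *: br x (rho' z' y)
          + (-1) ^+ (i * j + j * k) *: rho' (rho y z') x
          - (-1) ^+ (i * k) *: rho' (rho x z') y
    & forall (i j k : bool) x' y' z,
        x' \in homog A' i -> y' \in homog A' j -> z \in homog A k ->
        rho z (br' x' y') =
          br' (rho z x') y' + (-1) ^+ (i * k) *: br' x' (rho z y')
          + (-1) ^+ (i * j + j * k) *: rho (rho' y' z) x'
          - (-1) ^+ (i * k) *: rho (rho' x' z) y'].

Definition assoc_matched_pair (A1 A2 : superspace K)
    (mul1 : A1 -> A1 -> A1) (mul2 : A2 -> A2 -> A2)
    (phi1 : A1 -> A2 -> A2) (phi2 : A2 -> A1 -> A1) : Prop :=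
  [/\ assoc_representation mul1 phi1,
      assoc_representation mul2 phi2,
      forall (i k l : bool) x a b,
        x \in homog A1 i -> a \in homog A2 k -> b \in homog A2 l ->
        phi1 x (mul2 a b) =
          mul2 (phi1 x a) b + (-1) ^+ (i * k) *: phi1 (phi2 a x) b
    & forall (i j k : bool) x y a,
        x \in homog A1 i -> y \in homog A1 j -> a \in homog A2 k ->
        phi2 a (mul1 x y) =
          mul1 (phi2 a x) y + (-1) ^+ (i * k) *: phi2 (phi1 x a) y].

(* The extension to all vectors of an operation given by [f i j] on pairs of
   homogeneous vectors of parities [i] and [j]. *)
Definition homog_ext (V : superspace K) (f : bool -> bool -> V -> V -> V) (u v : V) : V :=
  \sum_(i : bool) \sum_(j : bool) f i j (part V i u) (part V j v).

Definition dsum_bracket (P1 P2 : superspace K)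
    (br1 : P1 -> P1 -> P1) (br2 : P2 -> P2 -> P2)
    (rho1 : P1 -> P2 -> P2) (rho2 : P2 -> P1 -> P1) :
    dsum P1 P2 -> dsum P1 P2 -> dsum P1 P2 :=
  homog_ext (fun (i j : bool) (u v : dsum P1 P2) =>
    let: (x, a) := u in let: (y, b) := v in
    (br1 x y + rho2 a y - (-1) ^+ (i * j) *: rho2 b x,
     br2 a b + rho1 x b - (-1) ^+ (i * j) *: rho1 y a)).

Definition dsum_product (P1 P2 : superspace K)
    (mul1 : P1 -> P1 -> P1) (mul2 : P2 -> P2 -> P2)
    (phi1 : P1 -> P2 -> P2) (phi2 : P2 -> P1 -> P1) :
    dsum P1 P2 -> dsum P1 P2 -> dsum P1 P2 :=
  homog_ext (fun (i j : bool) (u v : dsum P1 P2) =>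
    let: (x, a) := u in let: (y, b) := v in
    (mul1 x y + phi2 a y + (-1) ^+ (i * j) *: phi2 b x,
     mul2 a b + phi1 x b + (-1) ^+ (i * j) *: phi1 y a)).

Lemma even_bilinear0l (U V W : superspace K) (f : U -> V -> W) v :
  even_bilinear f -> f 0 v = 0.
Proof.
by case=> fl _ _; have := fl v (-1) 0 0; rewrite scaler0 addr0 scaleN1r addNr.
Qed.

Lemma even_bilinear0r (U V W : superspace K) (f : U -> V -> W) u :
  even_bilinear f -> f u 0 = 0.
Proof.
by case=> _ fr _; have := fr u (-1) 0 0; rewrite scaler0 addr0 scaleN1r addNr.
Qed.

Lemma homog_extE (V : superspace K) (f : bool -> bool -> V -> V -> V) i j u v :
    (forall k l w, f k l 0 w = 0) -> (forall k l w, f k l w 0 = 0) ->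
  u \in homog V i -> v \in homog V j -> homog_ext f u v = f i j u v.
Proof.
move=> f0l f0r ui vj; rewrite /homog_ext !big_bool /=.
rewrite !(part_homog _ ui) !(part_homog _ vj).
by case: i {ui}; case: j {vj}; rewrite /= ?f0l ?f0r ?add0r ?addr0.
Qed.

Lemma dsum_bracketE (P1 P2 : superspace K)
    (br1 : P1 -> P1 -> P1) (br2 : P2 -> P2 -> P2)
    (rho1 : P1 -> P2 -> P2) (rho2 : P2 -> P1 -> P1) (i j : bool) x y a b :
    even_bilinear br1 -> even_bilinear br2 ->
    even_bilinear rho1 -> even_bilinear rho2 ->
    x \in homog P1 i -> a \in homog P2 i -> y \in homog P1 j -> b \in homog P2 j ->
  dsum_bracket br1 br2 rho1 rho2 (x, a) (y, b) =
    (br1 x y + rho2 a y - (-1) ^+ (i * j) *: rho2 b x,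
     br2 a b + rho1 x b - (-1) ^+ (i * j) *: rho1 y a).
Proof.
move=> e1 e2 r1 r2 hx ha hy hb; rewrite /dsum_bracket (@homog_extE _ _ i j) //.
- move=> k l [z c] /=; rewrite !(even_bilinear0l _ e1, even_bilinear0l _ e2).
  rewrite !(even_bilinear0l _ r1, even_bilinear0l _ r2).
  by rewrite !(even_bilinear0r _ r1, even_bilinear0r _ r2) !scaler0 ?addr0 ?subr0.
- move=> k l [z c] /=; rewrite !(even_bilinear0r _ e1, even_bilinear0r _ e2).
  rewrite !(even_bilinear0l _ r1, even_bilinear0l _ r2).
  by rewrite !(even_bilinear0r _ r1, even_bilinear0r _ r2) !scaler0 ?addr0 ?subr0.
- by rewrite inE hx.
- by rewrite inE hy.
Qed.

Lemma dsum_productE (P1 P2 : superspace K)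
    (mul1 : P1 -> P1 -> P1) (mul2 : P2 -> P2 -> P2)
    (phi1 : P1 -> P2 -> P2) (phi2 : P2 -> P1 -> P1) (i j : bool) x y a b :
    even_bilinear mul1 -> even_bilinear mul2 ->
    even_bilinear phi1 -> even_bilinear phi2 ->
    x \in homog P1 i -> a \in homog P2 i -> y \in homog P1 j -> b \in homog P2 j ->
  dsum_product mul1 mul2 phi1 phi2 (x, a) (y, b) =
    (mul1 x y + phi2 a y + (-1) ^+ (i * j) *: phi2 b x,
     mul2 a b + phi1 x b + (-1) ^+ (i * j) *: phi1 y a).
Proof.
move=> e1 e2 r1 r2 hx ha hy hb; rewrite /dsum_product (@homog_extE _ _ i j) //.
- move=> k l [z c] /=; rewrite !(even_bilinear0l _ e1, even_bilinear0l _ e2).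
  rewrite !(even_bilinear0l _ r1, even_bilinear0l _ r2).
  by rewrite !(even_bilinear0r _ r1, even_bilinear0r _ r2) !scaler0 ?addr0.
- move=> k l [z c] /=; rewrite !(even_bilinear0r _ e1, even_bilinear0r _ e2).
  rewrite !(even_bilinear0l _ r1, even_bilinear0l _ r2).
  by rewrite !(even_bilinear0r _ r1, even_bilinear0r _ r2) !scaler0 ?addr0.
- by rewrite inE hx.
- by rewrite inE hy.
Qed.

End SuperAlgebra.

(* Main.v *)
(** Both sides of each Poisson axiom on the direct sum are sums of pairs, and
    exchanging P1 with P2 exchanges the two components, so only the component
    in P1 has to be checked. There, expanding by bilinearity leaves terms that
    the axioms of P1, the representation identities, the matched pair
    identities and the mixed conditions cancel, for each choice of parities. *)

Require Import Defs.
From mathcomp Require Import all_boot all_order all_algebra.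

Set Implicit Arguments.
Unset Strict Implicit.

Import GRing.Theory.
Local Open Scope ring_scope.

(** * Deciding identities of abelian groups by reflection *)

Inductive zexpr :=
  | ZVar of nat | ZZero | ZAdd of zexpr & zexpr | ZOpp of zexpr.

Fixpoint zeval (V : zmodType) (env : seq V) (e : zexpr) : V :=
  match e with
  | ZVar n => nth 0 env n
  | ZZero => 0
  | ZAdd e1 e2 => zeval env e1 + zeval env e2
  | ZOpp e1 => - zeval env e1
  end.

Fixpoint zcoef (e : zexpr) (k : nat) : int :=
  match e with
  | ZVar n => (k == n)%:Z
  | ZZero => 0
  | ZAdd e1 e2 => zcoef e1 k + zcoef e2 k
  | ZOpp e1 => - zcoef e1 k
  end.

(** A variable beyond the end of [env] takes the default value 0 of [nth] and has no index in the
    sum, so no bound on the variables of [e] is required. *)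
Lemma zevalE (V : zmodType) (env : seq V) e :
  zeval env e = \sum_(k < size env) env`_k *~ zcoef e k.
Proof.
elim: e => [n||e1 IH1 e2 IH2|e1 IH1] /=.
- have [lt_n|le_n] := ltnP n (size env).
    rewrite (bigD1 (Ordinal lt_n)) //= eqxx big1 ?addr0 // => k ne_k.
    by rewrite (_ : (k == n :> nat) = false) //; apply: negbTE ne_k.
  rewrite nth_default // big1 // => k _.
  by rewrite (_ : (k == n :> nat) = false) // ltn_eqF // (leq_trans _ le_n).
- by rewrite big1.
- by rewrite IH1 IH2 -big_split; apply: eq_bigr => k _; rewrite mulrzDr.
- by rewrite IH1 -sumrN; apply: eq_bigr => k _; rewrite mulrNz.
Qed.

(** The value depends only on the integer coefficients of the atoms, which turns an identity in [V]
    into a finite computation. *)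
Lemma zeval_eq (V : zmodType) (env : seq V) e1 e2 :
    all (fun k => zcoef e1 k == zcoef e2 k) (iota 0 (size env)) ->
  zeval env e1 = zeval env e2.
Proof.
move=> /allP eq12; rewrite !zevalE; apply: eq_bigr => k _.
by rewrite (eqP (eq12 k _)) // mem_iota /=.
Qed.

(* Atoms are compared up to unification: the same term may carry different but
   convertible structure instances. *)
Ltac index_of t env :=
  match env with
  | @cons _ ?u _ => let _ := match goal with _ => unify t u end in constr:(0%N)
  | @cons _ _ ?env' => let n := index_of t env' in constr:(S n)
  end.

Ltac add_atom t env :=
  match env with
  | _ => let _ := index_of t env in env
  | _ => constr:(cons t env)
  end.

Ltac atoms t env :=
  lazymatch t with
  | ?u + ?v => let env' := atoms u env in atoms v env'
  | - ?u => atoms u env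
  | 0 => env
  | _ => add_atom t env
  end.

Ltac reify_group t env :=
  lazymatch t with
  | ?u + ?v => let e1 := reify_group u env in
               let e2 := reify_group v env in constr:(ZAdd e1 e2)
  | - ?u => let e := reify_group u env in constr:(ZOpp e)
  | 0 => constr:(ZZero)
  | _ => let n := index_of t env in constr:(ZVar n)
  end.

(** A scaled vector counts as one atom, so scalings must be distributed and signs evaluated
    beforehand. *)
Ltac abelian :=
  lazymatch goal with
  | |- @eq ?T ?l ?r =>
    let env := atoms l (@nil T) in
    let env := atoms r env in
    let e1 := reify_group l env in
    let e2 := reify_group r env in
    apply: (@zeval_eq _ env e1 e2); vm_compute; reflexivity
  end.

(** * Evaluation of signs with known parities *)

Lemma sign_oddE (R : pzRingType) n b :
  odd n = b -> (-1) ^+ n = (if b then -1 else 1) :> R.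
Proof. by move=> <-; rewrite -signr_odd; case: odd. Qed.

Ltac eval_signs :=
  repeat match goal with
  | |- context [@GRing.exp ?R (- 1) ?n] =>
    let b := eval vm_compute in (odd n) in
    rewrite (@sign_oddE R n b (erefl b))
  end;
  rewrite ?(scale1r, scaleN1r).

(** * Expansion rules for even bilinear maps *)

Section EvenBilinear.

Variables (K : fieldType) (U V W : superspace K) (f : U -> V -> W).
Hypothesis f_even : even_bilinear f.

Lemma even_bilinearDl u v w : f (u + v) w = f u w + f v w.
Proof. by case: f_even => fl _ _; have := fl w 1 u v; rewrite !scale1r. Qed.

Lemma even_bilinearDr u v w : f u (v + w) = f u v + f u w.
Proof. by case: f_even => _ fr _; have := fr u 1 v w; rewrite !scale1r. Qed.

Lemma even_bilinearZl c u v : f (c *: u) v = c *: f u v.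
Proof.
case: f_even => fl _ _; have := fl v c u 0.
by rewrite (even_bilinear0l _ f_even) !addr0.
Qed.

Lemma even_bilinearZr c u v : f u (c *: v) = c *: f u v.
Proof.
case: f_even => _ fr _; have := fr u c v 0.
by rewrite (even_bilinear0r _ f_even) !addr0.
Qed.

Lemma even_bilinearNl u v : f (- u) v = - f u v.
Proof. by rewrite -scaleN1r even_bilinearZl scaleN1r. Qed.

Lemma even_bilinearNr u v : f u (- v) = - f u v.
Proof. by rewrite -scaleN1r even_bilinearZr scaleN1r. Qed.

Definition even_bilinearE :=
  (even_bilinearDl, even_bilinearDr, even_bilinearZl, even_bilinearZr,
   even_bilinearNl, even_bilinearNr).

Lemma even_bilinear_homog i j u v :
  u \in homog U i -> v \in homog V j -> f u v \in homog W (i (+) j).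
Proof. by case: f_even => _ _; apply. Qed.

End EvenBilinear.

(** Serves to pass from the twisted sums below to [dsum_bracket] and [dsum_product], with which they
    agree pointwise. *)
Lemma eq_even_bilinear (K : fieldType) (U V W : superspace K)
    (f g : U -> V -> W) :
  f =2 g -> even_bilinear f -> even_bilinear g.
Proof.
move=> fg [fl fr fh]; split=> [v c x y|u c x y|i j u v ui vj]; rewrite -!fg.
- exact: fl.
- exact: fr.
- exact: fh.
Qed.

(** * Homogeneous parts and bilinear extension from homogeneous vectors *)

Section Superspace.

Variables (K : fieldType) (V : superspace K).

Lemma homogZ i c x : x \in homog V i -> c *: x \in homog V i.
Proof.
move=> xi; have [V0 Vl] := homog_submod V i.
by have := Vl c x 0 xi V0; rewrite addr0.
Qed.

Lemma homogD i x y : x \in homog V i -> y \in homog V i -> x + y \in homog V i.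
Proof.
by move=> xi yi; have [_ Vl] := homog_submod V i; rewrite -[x]scale1r Vl.
Qed.

(** The difference of the two even parts equals, up to sign, that of the odd parts; being both even
    and odd, it vanishes. *)
Lemma part_unique x y z : y \in homog V false -> z \in homog V true ->
  x = y + z -> part V false x = y /\ part V true x = z.
Proof.
move=> y0 z1 xE; have xE' := part_sum x.
have d0 : part V false x - y = 0.
  apply: homog_disjoint; first by rewrite homogB ?homog_part.
  have -> : part V false x - y = z - part V true x.
    by apply/eqP; rewrite subr_eq addrAC eq_sym subr_eq -xE' xE addrC.
  by rewrite homogB ?homog_part.
have yE : part V false x = y by apply: subr0_eq.
by split=> //; move: xE'; rewrite yE {1}xE => /addrI.
Qed.

Lemma part_linear i : linear (part V i).
Proof.
move=> c x y.
have xyE : c *: x + y = (c *: part V false x + part V false y)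
                      + (c *: part V true x + part V true y).
  by rewrite {1}[x]part_sum {1}[y]part_sum scalerDr; abelian.
have homZD j : c *: part V j x + part V j y \in homog V j.
  by rewrite homogD ?homogZ ?homog_part.
by have [] := part_unique (homZD _) (homZD _) xyE; case: i.
Qed.

(** Each summand is bilinear because the projections [part V i] are linear; on homogeneous arguments
    a single summand survives, which gives the parity. *)
Lemma homog_ext_even_bilinear (f : bool -> bool -> V -> V -> V) :
    (forall i j v, linear (f i j ^~ v)) ->
    (forall i j u, linear (f i j u)) ->
    (forall i j u v, u \in homog V i -> v \in homog V j ->
      f i j u v \in homog V (i (+) j)) ->
  even_bilinear (homog_ext f).
Proof.
move=> fl fr fh.
have f0l i j v : f i j 0 v = 0.
  by have := fl i j v (-1) 0 0; rewrite scaler0 addr0 scaleN1r addNr.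
have f0r i j u : f i j u 0 = 0.
  by have := fr i j u (-1) 0 0; rewrite scaler0 addr0 scaleN1r addNr.
split=> [v c x y|u c x y|i j u v ui vj].
- rewrite /homog_ext scaler_sumr -big_split; apply: eq_bigr => i _.
  rewrite scaler_sumr -big_split; apply: eq_bigr => j _.
  by rewrite part_linear fl.
- rewrite /homog_ext scaler_sumr -big_split; apply: eq_bigr => i _.
  rewrite scaler_sumr -big_split; apply: eq_bigr => j _.
  by rewrite part_linear fr.
- by rewrite (homog_extE f0l f0r ui vj) fh.
Qed.

End Superspace.

(** * One component of an operation on a direct sum *)

Section TwistedSum.

Variables (K : fieldType) (A A' : superspace K).
Variables (op : A -> A -> A) (act : A' -> A -> A).
Hypotheses (op_even : even_bilinear op) (act_even : even_bilinear act).

(* The component in A of an operation on A + A'; the component in A' has the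
   same shape, with A and A' exchanged. *)
Definition twisted_sum (s : K) (x : A) (a : A') (y : A) (b : A') : A :=
  op x y + act a y + s *: act b x.

Lemma twisted_sum_homog s i j x a y b :
    x \in homog A i -> a \in homog A' i -> y \in homog A j ->
    b \in homog A' j ->
  twisted_sum s x a y b \in homog A (i (+) j).
Proof.
move=> xi ai yj bj; rewrite /twisted_sum !homogD ?homogZ //.
- exact: even_bilinear_homog.
- exact: even_bilinear_homog.
- by rewrite addbC; apply: even_bilinear_homog.
Qed.

(** Linearity is joint in the pair [(x, a)], with the sign [s] held fixed as it is on each pair of
    parities. *)
Lemma twisted_sum_linearl s c x a x' a' y b :
  twisted_sum s (c *: x + x') (c *: a + a') y b =
  c *: twisted_sum s x a y b + twisted_sum s x' a' y b.
Proof.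
rewrite /twisted_sum !(even_bilinearE op_even).
rewrite !(even_bilinearE act_even) !scalerDr !scalerA (mulrC s).
by abelian.
Qed.

Lemma twisted_sum_linearr s c x a y b y' b' :
  twisted_sum s x a (c *: y + y') (c *: b + b') =
  c *: twisted_sum s x a y b + twisted_sum s x a y' b'.
Proof.
rewrite /twisted_sum !(even_bilinearE op_even).
rewrite !(even_bilinearE act_even) !scalerDr !scalerA (mulrC s).
by abelian.
Qed.

End TwistedSum.

(** * The bracket and the product on the direct sum *)

Section DirectSumOperations.

Variables (K : fieldType) (P1 P2 : superspace K).
Variables (op1 : P1 -> P1 -> P1) (op2 : P2 -> P2 -> P2).
Variables (act1 : P1 -> P2 -> P2) (act2 : P2 -> P1 -> P1).
Hypotheses (op1_even : even_bilinear op1) (op2_even : even_bilinear op2).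
Hypotheses (act1_even : even_bilinear act1) (act2_even : even_bilinear act2).

(** The scalar [s] is arbitrary so that bracket and product, which differ in the sign of their last
    term, are treated at once. *)
Lemma twisted_dsum_even_bilinear (s : bool -> bool -> K) :
  even_bilinear (homog_ext (fun i j (u v : dsum P1 P2) =>
    (twisted_sum op1 act2 (s i j) u.1 u.2 v.1 v.2,
     twisted_sum op2 act1 (s i j) u.2 u.1 v.2 v.1) : dsum P1 P2)).
Proof.
apply: homog_ext_even_bilinear.
- move=> i j [y b] c [x a] [x' a'] /=.
  by congr pair; rewrite twisted_sum_linearl.
- move=> i j [x a] c [y b] [y' b'] /=.
  by congr pair; rewrite twisted_sum_linearr.
- move=> i j [x a] [y b] /andP[/= xi ai] /andP[/= yj bj].
  by apply/andP; split; apply: twisted_sum_homog.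
Qed.

Lemma dsum_bracket_even : even_bilinear (dsum_bracket op1 op2 act1 act2).
Proof.
apply: eq_even_bilinear (twisted_dsum_even_bilinear
  (fun i j => - (-1) ^+ (i * j))) => u v.
rewrite /dsum_bracket /homog_ext; apply: eq_bigr => i _; apply: eq_bigr => j _.
by case: u v => [x a] [y b]; rewrite /twisted_sum !scaleNr.
Qed.

Lemma dsum_product_even : even_bilinear (dsum_product op1 op2 act1 act2).
Proof.
apply: eq_even_bilinear (twisted_dsum_even_bilinear
  (fun i j => (-1) ^+ (i * j))) => u v.
rewrite /dsum_product /homog_ext; apply: eq_bigr => i _; apply: eq_bigr => j _.
by case: u v => [x a] [y b].
Qed.

Section Homogeneous.

Variables (i j : bool) (x y : P1) (a b : P2).
Hypotheses (xi : x \in homog P1 i) (ai : a \in homog P2 i).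
Hypotheses (yj : y \in homog P1 j) (bj : b \in homog P2 j).

Lemma dsum_bracket_twisted : dsum_bracket op1 op2 act1 act2 (x, a) (y, b) =
  (twisted_sum op1 act2 (- (-1) ^+ (i * j)) x a y b,
   twisted_sum op2 act1 (- (-1) ^+ (i * j)) a x b y).
Proof.
by rewrite (dsum_bracketE op1_even op2_even act1_even act2_even xi ai yj bj)
  /twisted_sum !scaleNr.
Qed.

Lemma dsum_product_twisted : dsum_product op1 op2 act1 act2 (x, a) (y, b) =
  (twisted_sum op1 act2 ((-1) ^+ (i * j)) x a y b,
   twisted_sum op2 act1 ((-1) ^+ (i * j)) a x b y).
Proof.
exact: (dsum_productE op1_even op2_even act1_even act2_even xi ai yj bj).
Qed.

End Homogeneous.

End DirectSumOperations.

Ltac sign_abelian :=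
  eval_signs; rewrite ?(scalerDr, scalerN, scaleNr, scale1r); abelian.

(** * The Poisson axioms in the component P1 *)

Section FirstComponent.

Variables (K : fieldType) (P1 P2 : superspace K).
Variables (br1 mul1 : P1 -> P1 -> P1) (br2 mul2 : P2 -> P2 -> P2).
Variables (rho1 phi1 : P1 -> P2 -> P2) (rho2 phi2 : P2 -> P1 -> P1).

Section Parities.

Variables (i j k : bool) (x y z : P1) (a b c : P2).
Hypotheses (xi : x \in homog P1 i) (ai : a \in homog P2 i).
Hypotheses (yj : y \in homog P1 j) (bj : b \in homog P2 j).
Hypotheses (zk : z \in homog P1 k) (ck : c \in homog P2 k).

Let bracket1 (i j : bool) := twisted_sum br1 rho2 (- (-1) ^+ (i * j)).
Let bracket2 (i j : bool) := twisted_sum br2 rho1 (- (-1) ^+ (i * j)).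
Let product1 (i j : bool) := twisted_sum mul1 phi2 ((-1) ^+ (i * j)).
Let product2 (i j : bool) := twisted_sum mul2 phi1 ((-1) ^+ (i * j)).

(** Terms are sorted by their entries from P2: with none, the Jacobi identity of P1 applies; with
    one, the matched pair identity; with two, the representation identity of [rho2]. *)
Lemma jacobi_fst :
    lie_superalgebra br1 -> lie_matched_pair br1 br2 rho1 rho2 ->
  (-1) ^+ (i * k) *: bracket1 i (j (+) k) x a
                       (bracket1 j k y b z c) (bracket2 j k b y c z)
  + (-1) ^+ (k * j) *: bracket1 k (i (+) j) z c
                         (bracket1 i j x a y b) (bracket2 i j a x b y)
  + (-1) ^+ (j * i) *: bracket1 j (k (+) i) y b
                         (bracket1 k i z c x a) (bracket2 k i c z a x) = 0.
Proof.
move=> [br1_even skew1 jacobi1] [_ [rho2_even rho2_br] matched1 _].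
rewrite /bracket1 /bracket2 /twisted_sum.
rewrite !(even_bilinearE br1_even) !(even_bilinearE rho2_even).
have homr := even_bilinear_homog rho2_even.
rewrite (matched1 _ _ _ _ _ _ yj zk ai) (matched1 _ _ _ _ _ _ zk xi bj).
rewrite (matched1 _ _ _ _ _ _ xi yj ck).
rewrite (rho2_br _ _ _ _ bj ck) (rho2_br _ _ _ _ ck ai) (rho2_br _ _ _ _ ai bj).
(* Brackets with a value of [rho2] on the left are reversed to match those coming from the outer
   bracket. *)
rewrite (skew1 _ _ _ _ (homr _ _ _ _ ai yj) zk).
rewrite (skew1 _ _ _ _ (homr _ _ _ _ bj zk) xi).
rewrite (skew1 _ _ _ _ (homr _ _ _ _ ck xi) yj).
(* The right-hand 0 becomes the Jacobi sum of P1, so that both sides have the same terms. *)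
rewrite -(jacobi1 _ _ _ _ _ _ xi yj zk).
(* Homogeneity has been used up; clearing it frees the parities for a case analysis into eight sign
   patterns. *)
by clear; case: i; case: j; case: k; sign_abelian.
Qed.

(** With no entry from P2 this is associativity of [mul1]; with one, the matched pair identity and
    commutativity of [mul1]; with two, multiplicativity of [phi2] and commutativity of [mul2]. *)
Lemma associative_fst :
    comm_assoc_superalgebra mul1 -> comm_assoc_superalgebra mul2 ->
    assoc_matched_pair mul1 mul2 phi1 phi2 ->
  product1 i (j (+) k) x a (product1 j k y b z c) (product2 j k b y c z) =
  product1 (i (+) j) k (product1 i j x a y b) (product2 i j a x b y) z c.
Proof.
move=> [mul1_even comm1 assoc1] [_ comm2 _].
move=> [_ [phi2_even phi2_mul] _ matched1].
rewrite /product1 /product2 /twisted_sum.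
rewrite !(even_bilinearE mul1_even) !(even_bilinearE phi2_even).
have homp := even_bilinear_homog phi2_even.
(* The middle entry [b] acts on [z] on one side and on [x] on the other; [Eb] and [Eb'] express both
   products through [phi2 b (mul1 x z)]. *)
have Eb : mul1 (phi2 b x) z =
    phi2 b (mul1 x z) - (-1) ^+ (i * j) *: phi2 (phi1 x b) z.
  by rewrite (matched1 _ _ _ _ _ _ xi zk bj) addrK.
have Eb' : mul1 (phi2 b z) x =
    (-1) ^+ (k * i) *: phi2 b (mul1 x z) - (-1) ^+ (k * j) *: phi2 (phi1 z b) x.
  rewrite -(even_bilinearZr phi2_even) -(comm1 _ _ _ _ zk xi).
  by rewrite (matched1 _ _ _ _ _ _ zk xi bj) addrK.
have Eac : phi2 a (phi2 c y) = (-1) ^+ (i * k) *: phi2 c (phi2 a y).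
  rewrite -(phi2_mul _ _ _ _ ai ck) (comm2 _ _ _ _ ai ck).
  by rewrite (even_bilinearZl phi2_even) (phi2_mul _ _ _ _ ck ai).
rewrite (comm1 _ _ _ _ xi (homp _ _ _ _ bj zk)) Eb Eb' Eac.
rewrite (matched1 _ _ _ _ _ _ yj zk ai) (phi2_mul _ _ _ _ ai bj).
rewrite (comm1 _ _ _ _ xi (homp _ _ _ _ ck yj)).
rewrite (comm1 _ _ _ _ xi yj) (even_bilinearZr phi2_even).
rewrite (matched1 _ _ _ _ _ _ yj xi ck).
rewrite (comm2 _ _ _ _ bj ck) (even_bilinearZl phi2_even).
rewrite (phi2_mul _ _ _ _ ck bj) (assoc1 _ _ _ _ _ _ xi yj zk).
(* The earlier exchange of [x] and [y] also affected the triple product on the right; the one just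
   produced by associativity must follow. *)
rewrite (comm1 _ _ _ _ xi yj) (even_bilinearZl mul1_even).
by clear; case: i; case: j; case: k; sign_abelian.
Qed.

(** The first mixed condition settles the terms in [a] alone, the second those in [b] or [c] alone.
    Terms with two entries from P2 come from the Poisson representation, those with none from the
    Leibniz rule of P1. *)
Lemma leibniz_fst :
    poisson_superalgebra br1 mul1 -> even_bilinear phi2 ->
    poisson_representation br2 mul2 rho2 phi2 ->
    (forall (i j k : bool) x y a,
      x \in homog P1 i -> y \in homog P1 j -> a \in homog P2 k ->
      rho2 a (mul1 x y) =
        mul1 (rho2 a x) y + (-1) ^+ (k * i) *: mul1 x (rho2 a y)
        - (-1) ^+ (k * i) *: phi2 (rho1 x a) y
        - (-1) ^+ (k * j + i * j) *: phi2 (rho1 y a) x) ->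
    (forall (i j k : bool) x y a,
      x \in homog P1 i -> y \in homog P1 j -> a \in homog P2 k ->
      br1 x (phi2 a y) - (-1) ^+ (i * k + i * j + k * j) *: rho2 (phi1 y a) x =
        phi2 (rho1 x a) y - (-1) ^+ (i * k) *: mul1 (rho2 a x) y
        + (-1) ^+ (i * k) *: phi2 a (br1 x y)) ->
  bracket1 i (j (+) k) x a (product1 j k y b z c) (product2 j k b y c z) =
  product1 (i (+) j) k (bracket1 i j x a y b) (bracket2 i j a x b y) z c
  + (-1) ^+ (i * j) *:
    product1 j (i (+) k) y b (bracket1 i k x a z c) (bracket2 i k a x c z).
Proof.
move=> [[br1_even _ _] [mul1_even comm1 _] leibniz1] phi2_even.
move=> [[rho2_even _] _ rho2_mul phi2_br] rho2_mul1 br1_phi2.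
rewrite /bracket1 /bracket2 /product1 /product2 /twisted_sum.
rewrite !(even_bilinearE mul1_even) !(even_bilinearE phi2_even).
rewrite !(even_bilinearE br1_even) !(even_bilinearE rho2_even).
have homr := even_bilinear_homog rho2_even.
rewrite (leibniz1 _ _ _ _ _ _ xi yj zk) (rho2_mul1 _ _ _ _ _ _ yj zk ai).
rewrite (rho2_mul _ _ _ _ bj ck) (phi2_br _ _ _ _ ai bj) (phi2_br _ _ _ _ ai ck).
(* The second mixed condition is solved for [br1 x (phi2 b z)]. *)
move/eqP: (br1_phi2 _ _ _ _ _ _ xi zk bj); rewrite subr_eq => /eqP ->.
move/eqP: (br1_phi2 _ _ _ _ _ _ xi yj ck); rewrite subr_eq => /eqP ->.
rewrite (comm1 _ _ _ _ yj (homr _ _ _ _ ck xi)).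
by clear; case: i; case: j; case: k; sign_abelian.
Qed.

End Parities.
End FirstComponent.

(** * Assembly of the two components *)

Unset Implicit Arguments.
Set Strict Implicit.

Theorem theorem2p5 (K : fieldType) (charK0 : [pchar K] =i pred0)
    (P1 P2 : superspace K)
    (br1 mul1 : P1 -> P1 -> P1) (br2 mul2 : P2 -> P2 -> P2)
    (rho1 phi1 : P1 -> P2 -> P2) (rho2 phi2 : P2 -> P1 -> P1)
    (P1_poisson : poisson_superalgebra br1 mul1)
    (P2_poisson : poisson_superalgebra br2 mul2)
    (rho1_even : even_bilinear rho1) (phi1_even : even_bilinear phi1)
    (rho2_even : even_bilinear rho2) (phi2_even : even_bilinear phi2)
    (lie_matched : lie_matched_pair br1 br2 rho1 rho2)
    (assoc_matched : assoc_matched_pair mul1 mul2 phi1 phi2)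
    (P2_rep : poisson_representation br1 mul1 rho1 phi1)
    (P1_rep : poisson_representation br2 mul2 rho2 phi2)
    (compat1 : forall (i j k : bool) x y a,
      x \in homog P1 i -> y \in homog P1 j -> a \in homog P2 k ->
      rho2 a (mul1 x y) =
        mul1 (rho2 a x) y + (-1) ^+ (k * i) *: mul1 x (rho2 a y)
        - (-1) ^+ (k * i) *: phi2 (rho1 x a) y
        - (-1) ^+ (k * j + i * j) *: phi2 (rho1 y a) x)
    (compat2 : forall (i j k : bool) x y a,
      x \in homog P1 i -> y \in homog P1 j -> a \in homog P2 k ->
      br1 x (phi2 a y) - (-1) ^+ (i * k + i * j + k * j) *: rho2 (phi1 y a) x =
        phi2 (rho1 x a) y - (-1) ^+ (i * k) *: mul1 (rho2 a x) y
        + (-1) ^+ (i * k) *: phi2 a (br1 x y))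
    (compat3 : forall (i k l : bool) x a b,
      x \in homog P1 i -> a \in homog P2 k -> b \in homog P2 l ->
      rho1 x (mul2 a b) =
        mul2 (rho1 x a) b + (-1) ^+ (i * k) *: mul2 a (rho1 x b)
        - (-1) ^+ (i * k) *: phi1 (rho2 a x) b
        - (-1) ^+ (i * l + k * l) *: phi1 (rho2 b x) a)
    (compat4 : forall (i k l : bool) x a b,
      x \in homog P1 i -> a \in homog P2 k -> b \in homog P2 l ->
      br2 a (phi1 x b) - (-1) ^+ (k * i + k * l + i * l) *: rho1 (phi2 b x) a =
        phi1 (rho2 a x) b - (-1) ^+ (k * i) *: mul2 (rho1 x a) b
        + (-1) ^+ (k * i) *: phi1 x (br2 a b)) :
  poisson_superalgebra (dsum_bracket br1 br2 rho1 rho2)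
                       (dsum_product mul1 mul2 phi1 phi2).
Proof.
have [lie1 comm1 _] := P1_poisson.
have [lie2 comm2 _] := P2_poisson.
have [br1_even skew1 _] := lie1; have [br2_even skew2 _] := lie2.
have [mul1_even mul1C _] := comm1; have [mul2_even mul2C _] := comm2.
(* The reversed matched pairs supply the hypotheses for the components in P2. *)
have lie_matched' : lie_matched_pair br2 br1 rho2 rho1.
  by case: lie_matched => ? ? ? ?.
have assoc_matched' : assoc_matched_pair mul2 mul1 phi2 phi1.
  case: assoc_matched => ? ? m1 m2; split=> // i j k u v w ui vj wk.
    by rewrite mulnC; apply: m2 vj wk ui.
  by rewrite mulnC; apply: m1 wk ui vj.
have brE := dsum_bracket_twisted br1_even br2_even rho1_even rho2_even.
have mulE := dsum_product_twisted mul1_even mul2_even phi1_even phi2_even.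
have hom_br1 := twisted_sum_homog br1_even rho2_even.
have hom_br2 := twisted_sum_homog br2_even rho1_even.
have hom_mul1 := twisted_sum_homog mul1_even phi2_even.
have hom_mul2 := twisted_sum_homog mul2_even phi1_even.
split; first split.
- exact: dsum_bracket_even.
- move=> i j [x a] [y b] /andP[/= xi ai] /andP[/= yj bj].
  rewrite (brE _ _ _ _ _ _ xi ai yj bj) (brE _ _ _ _ _ _ yj bj xi ai)
    /twisted_sum.
  (* Only the inner brackets need skew-symmetry; the action terms are exchanged by the formula
     itself. *)
  rewrite (skew1 _ _ _ _ xi yj) (skew2 _ _ _ _ ai bj).
  by congr pair; rewrite /=; clear; case: i; case: j; sign_abelian.
- move=> i j k [x a] [y b] [z c].
  move=> /andP[/= xi ai] /andP[/= yj bj] /andP[/= zk ck].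
  rewrite (brE _ _ _ _ _ _ yj bj zk ck) (brE _ _ _ _ _ _ xi ai yj bj)
    (brE _ _ _ _ _ _ zk ck xi ai).
  (* Both components of the inner bracket have parity [j (+) k], so the outer bracket unfolds as
     well. *)
  rewrite (brE _ (j (+) k) _ _ _ _ xi ai) ?hom_br1 ?hom_br2 //.
  rewrite (brE _ (i (+) j) _ _ _ _ zk ck) ?hom_br1 ?hom_br2 //.
  rewrite (brE _ (k (+) i) _ _ _ _ yj bj) ?hom_br1 ?hom_br2 //.
  by congr pair; apply: jacobi_fst.
- split; first exact: dsum_product_even.
  + move=> i j [x a] [y b] /andP[/= xi ai] /andP[/= yj bj].
    rewrite (mulE _ _ _ _ _ _ xi ai yj bj) (mulE _ _ _ _ _ _ yj bj xi ai)
      /twisted_sum.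
    rewrite (mul1C _ _ _ _ xi yj) (mul2C _ _ _ _ ai bj).
    by congr pair; rewrite /=; clear; case: i; case: j; sign_abelian.
  + move=> i j k [x a] [y b] [z c].
    move=> /andP[/= xi ai] /andP[/= yj bj] /andP[/= zk ck].
    rewrite (mulE _ _ _ _ _ _ yj bj zk ck) (mulE _ _ _ _ _ _ xi ai yj bj).
    rewrite (mulE _ (j (+) k) _ _ _ _ xi ai) ?hom_mul1 ?hom_mul2 //.
    rewrite (mulE (i (+) j) k) ?hom_mul1 ?hom_mul2 //.
    by congr pair; apply: associative_fst.
- move=> i j k [x a] [y b] [z c].
  move=> /andP[/= xi ai] /andP[/= yj bj] /andP[/= zk ck].
  rewrite (mulE _ _ _ _ _ _ yj bj zk ck) (brE _ _ _ _ _ _ xi ai yj bj)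
    (brE _ _ _ _ _ _ xi ai zk ck).
  rewrite (brE _ (j (+) k) _ _ _ _ xi ai) ?hom_mul1 ?hom_mul2 //.
  rewrite (mulE (i (+) j) k) ?hom_br1 ?hom_br2 //.
  rewrite (mulE _ (i (+) k) _ _ _ _ yj bj) ?hom_br1 ?hom_br2 //.
  congr pair; first exact: leibniz_fst.
  (* With P1 and P2 exchanged, [compat3] and [compat4] are the mixed conditions required, up to the
     order of the variables. *)
  apply: leibniz_fst => // l m n u v w ul vm wn; first exact: compat3 wn ul vm.
  exact: compat4 wn ul vm.
Qed.
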